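(* Let $X\in\{0,1\}^{n\times m}$ be a binary matrix and let $k>1$ be an integer. Then the linear program $\text{LP}_{\text{exact}}$ (the LP relaxation of $\text{IP}_{\text{exact}}$ for $X$ and $k$) has optimal objective value $0$, and this value is attained by at least $\binom{k}{2}$ solutions.
   Context: For a positive integer $n$ write $[n]=\{1,\dots,n\}$. For $X\in\{0,1\}^{n\times m}$ let $E=\{(i,j)\in[n]\times[m] : x_{ij}=1\}$; the notation $(i,j)\notin E$ means $(i,j)\in([n]\times[m])\setminus E$. Let $\mathcal{F}=[n]\times[k]\times[m]$. For reals $a,b$ define the McCormick envelope $MC(a,b)=\{y\in\mathbb{R} : a+b-1\le y,\ y\le a,\ y\le b,\ 0\le y\}$. The integer program $\text{IP}_{\text{exact}}$ (modelling rank-$k$ binary matrix factorisation of $X$ under Boolean arithmetic) has variables $a_{i\ell}$, $b_{\ell j}$, $y_{i\ell j}$, $z_{ij}$ for $(i,\ell,j)\in\mathcal{F}$, and is $$\min_{a,b,y,z}\ \sum_{(i,j)\in E}(1-z_{ij})+\sum_{(i,j)\notin E} z_{ij}$$ subject to, for all $(i,\ell,j)\in\mathcal{F}$, $$y_{i\ell j}\le z_{ij}\le\sum_{\ell'=1}^k y_{i\ell' j},\qquad y_{i\ell j}\in MC(a_{i\ell},b_{\ell j}),\qquad a_{i\ell},b_{\ell j}\in\{0,1\},\qquad z_{ij}\le 1.$$ The LP relaxation $\text{LP}_{\text{exact}}$ is obtained by replacing $a_{i\ell},b_{\ell j}\in\{0,1\}$ with $a_{i\ell},b_{\ell j}\in[0,1]$.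 A solution is a feasible assignment of all the variables $(a,b,y,z)$. *)

(* Defs.v *)
From mathcomp Require Import all_boot all_order all_algebra.
From mathcomp Require Import reals.
Set Implicit Arguments.
Unset Strict Implicit.
Unset Printing Implicit Defensive.
Import Order.TTheory GRing.Theory Num.Theory.
Local Open Scope ring_scope.

(* A binary matrix X in {0,1}^(n x m) is an 'M[bool]_(n, m), true standing
   for 1; the index set [n] is 'I_n (numbered from 0). *)
Definition ones (n m : nat) (X : 'M[bool]_(n, m)) : {set 'I_n * 'I_m} :=
  [set p | X p.1 p.2].

Definition McCormick (R : realType) (a b : R) : {pred R} :=
  [pred y | [&& a + b - 1 <= y, y <= a, y <= b & 0 <= y]].

(* All components are finite tables (not bare functions), so that
   equality of assignments is equality of all variables. *)
Record assignment (R : realType) (n k m : nat) := Assignment {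
  va : 'M[R]_(n, k);
  vb : 'M[R]_(k, m);
  vy : {ffun 'I_n * 'I_k * 'I_m -> R};
  vz : 'M[R]_(n, m)
}.

Definition objective (R : realType) (n k m : nat) (X : 'M[bool]_(n, m))
    (s : assignment R n k m) : R :=
  \sum_(p in ones X) (1 - vz s p.1 p.2)
    + \sum_(p in ~: ones X) vz s p.1 p.2.

(* D is the domain of the variables a and b: {0,1} for the integer program,
   [0,1] for its linear relaxation. X only enters through the objective. *)
Definition feasible_over (R : realType) (D : {pred R}) (n k m : nat)
    (s : assignment R n k m) : Prop :=
  forall (i : 'I_n) (l : 'I_k) (j : 'I_m),
    [/\ vy s (i, l, j) <= vz s i j <= \sum_(l' < k) vy s (i, l', j),
        vy s (i, l, j) \in McCormick (va s i l) (vb s l j),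
        va s i l \in D,
        vb s l j \in D &
        vz s i j <= 1].

Definition IP_exact_feasible (R : realType) (n k m : nat)
    (s : assignment R n k m) : Prop :=
  feasible_over (pred2 0 1) s.

Definition LP_exact_feasible (R : realType) (n k m : nat)
    (s : assignment R n k m) : Prop :=
  feasible_over (mem `[0, 1]) s.

Definition is_min_value (R : realType) (T : Type) (F : T -> Prop) (f : T -> R)
    (v : R) : Prop :=
  (exists2 s, F s & f s = v) /\ (forall s, F s -> v <= f s).

(* Main.v *)
Require Import Defs.
From mathcomp Require Import all_boot all_order all_algebra.
From mathcomp Require Import reals.
From mathcomp Require Import lra.
Set Implicit Arguments.
Unset Strict Implicit.
Unset Printing Implicit Defensive.
Import Order.TTheory GRing.Theory Num.Theory.
Local Open Scope ring_scope.

(** The objective is nonnegative on the relaxation because the constraints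
    force every [z i j] into [0, 1]. Value 0 means [z = X], and the relaxation
    allows this for every [X]: with [a = b = 1/2] the McCormick envelope is
    [[0, 1/2]], so [y] is free to be either 0, as a zero of [X] requires, or
    1/2, and two indices [l] with [y = 1/2] already sum to the 1 that a one of
    [X] requires. The other indices [l] can be switched off by [a = b = 0].
    Hence every set [S] of at least two of the [k] indices carries an optimal
    solution. The 2-subsets alone give the binomial count; they are told apart
    by the [a] variables, which do not depend on [X], so that the solutions
    remain distinct even when [X = 0] makes all the [y] vanish. *)

Definition half_indicator (R : realType) (k : nat) (S : {set 'I_k}) (l : 'I_k) : R :=
  if l \in S then 1 / 2 else 0.

Definition half_solution (R : realType) (n k m : nat) (X : 'M[bool]_(n, m))
    (S : {set 'I_k}) : assignment R n k m :=
  Assignment (\matrix_(i, l) half_indicator R S l)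
             (\matrix_(l, j) half_indicator R S l)
             [ffun p => if X p.1.1 p.2 then half_indicator R S p.1.2 else 0]
             (\matrix_(i, j) (X i j)%:R).

Lemma sum_half_indicator (R : realType) (k : nat) (S : {set 'I_k}) :
  \sum_l half_indicator R S l = #|S|%:R / 2.
Proof. by rewrite -big_mkcond sumr_const -[LHS]mulr_natl div1r. Qed.

(** At a one of [X] the constraint [z <= sum y] reads [1 <= #|S| / 2], which
    is where two elements of [S] are needed. *)
Lemma half_solution_feasible (R : realType) (n k m : nat)
    (X : 'M[bool]_(n, m)) (S : {set 'I_k}) :
  (1 < #|S|)%N -> LP_exact_feasible (half_solution R X S).
Proof.
move=> S_gt1 i l j.
have half_ge1 : 1 <= #|S|%:R / 2 :> R.
  by rewrite ler_pdivlMr ?mul1r ?ltr0n ?ler_nat.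
have half_bounds : 0 <= half_indicator R S l <= 1 / 2.
  by rewrite /half_indicator; case: ifP => _; lra.
rewrite /half_solution /= !mxE ffunE /=.
under eq_bigr do rewrite ffunE /=.
split; [ | | | | by case: (X i j)].
- case: (X i j); first by rewrite sum_half_indicator mulr1n half_ge1 andbT; lra.
  by rewrite big1 ?lexx.
- by rewrite inE; case: (X i j); lra.
- by rewrite in_itv /=; lra.
- by rewrite in_itv /=; lra.
Qed.

Lemma half_solution_objective (R : realType) (n k m : nat)
    (X : 'M[bool]_(n, m)) (S : {set 'I_k}) :
  objective X (half_solution R X S) = 0.
Proof.
rewrite /objective !big1 ?addr0 // => -[i j]; rewrite !inE /= mxE.
- by move/negbTE ->.
- by move ->; rewrite subrr.
Qed.

Lemma half_solution_inj (R : realType) (n k m : nat) (X : 'M[bool]_(n, m)) :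
  (0 < n)%N -> injective (@half_solution R n k m X).
Proof.
move=> n_gt0 S T [/matrixP eq_a _ _]; apply/setP => l.
have := eq_a (Ordinal n_gt0) l; rewrite !mxE /half_indicator.
by case: (l \in S); case: (l \in T) => //; lra.
Qed.

(** An index [l] is needed to link [z] to the variables [y >= 0] below it:
    for [k = 0] there is no constraint at all. *)
Lemma LP_exact_objective_ge0 (R : realType) (n k m : nat)
    (X : 'M[bool]_(n, m)) (s : assignment R n k m) :
  (0 < k)%N -> LP_exact_feasible s -> 0 <= objective X s.
Proof.
move=> k_gt0 s_feasible.
have z_bounds i j : 0 <= vz s i j <= 1.
  have [/andP[yz _] /and4P[_ _ _ y_ge0] _ _ z_le1] :=
    s_feasible i (Ordinal k_gt0) j.
  by rewrite z_le1 (le_trans y_ge0 yz).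
apply: addr_ge0; apply: sumr_ge0 => -[i j] _ /=.
- by rewrite subr_ge0; case/andP: (z_bounds i j).
- by case/andP: (z_bounds i j).
Qed.

Theorem lemma1 (R : realType) (n m k : nat) (X : 'M[bool]_(n, m))
    (hn : (0 < n)%N) (hm : (0 < m)%N) (hk : (1 < k)%N) :
  is_min_value (@LP_exact_feasible R n k m) (objective X) 0 /\
  exists f : 'I_('C(k, 2)) -> assignment R n k m,
    injective f /\
    forall t, LP_exact_feasible (f t) /\ objective X (f t) = 0.
Proof.
split.
  split; last by move=> s; apply: LP_exact_objective_ge0; apply: ltnW.
  exists (half_solution R X [set: 'I_k]); last exact: half_solution_objective.
  by apply: half_solution_feasible; rewrite cardsT card_ord.
pose pairs := [set S : {set 'I_k} | #|S| == 2].
have card_pairs : 'C(k, 2) = #|pairs| by rewrite card_draws card_ord.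
exists (fun t => half_solution R X (enum_val (cast_ord card_pairs t))); split.
  by move=> t u /(half_solution_inj hn)/enum_val_inj/cast_ord_inj.
move=> t; split; last exact: half_solution_objective.
apply: half_solution_feasible.
by have := enum_valP (cast_ord card_pairs t); rewrite inE => /eqP ->.
Qed.
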